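(* Let $\mathcal{F}\colon \mathbf{C} \to \mathbf{D}$ be a faithful functor, let $A \in \operatorname{Obj}(\mathbf{C})$, and let $f \in \operatorname{Epi}_{\mathcal{F}}(A,-)$ with target $A/f$. Let $\uparrow[f]_\sim = \{\, [g]_\sim \in \operatorname{Quo}_{\mathcal{F}}(A) \mid f \leq g \,\}$ be the principal filter of $\operatorname{Quo}_{\mathcal{F}}(A)$ generated by the $\mathcal{F}$-quotient $[f]_\sim$. Then the partially ordered classes $(\uparrow[f]_\sim, \leq)$ and $(\operatorname{Quo}_{\mathcal{F}}(A/f), \leq)$ are isomorphic.
   Context: Let $\mathcal{F}\colon \mathbf{C} \to \mathbf{D}$ be a faithful functor. A morphism $f$ of $\mathbf{C}$ is an $\mathcal{F}$-epimorphism if $\mathcal{F}(f)$ is an epimorphism in $\mathbf{D}$. For $A \in \operatorname{Obj}(\mathbf{C})$, $\operatorname{Epi}_{\mathcal{F}}(A,-)$ is the class of all $\mathcal{F}$-epimorphisms with source $A$. For $f\colon A \to B$ and $g\colon A \to C$ in $\operatorname{Epi}_{\mathcal{F}}(A,-)$, write $f \leq g$ if there is a morphism $h\colon B \to C$ in $\mathbf{C}$ with $g = h \circ f$; this is a preorder. Write $f \sim g$ if $f \leq g$ and $g \leq f$. The equivalence classes $[f]_\sim$ are the $\mathcal{F}$-quotients of $A$, and the class of all of them is $\operatorname{Quo}_{\mathcal{F}}(A)$, partially ordered by $[f]_\sim \leq [g]_\sim \iff f \leq g$. For $f\colon A \to B$ in $\operatorname{Epi}_{\mathcal{F}}(A,-)$,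 the target object $B$ is denoted $A/f$. *)

(* Defs.v *)
From Stdlib Require Import Relation_Definitions ProofIrrelevance
  FunctionalExtensionality PropExtensionality.
From Corelib Require Import ssreflect ssrfun.

Set Implicit Arguments.
Unset Strict Implicit.
Unset Printing Implicit Defensive.

Record category := Category {
  obj :> Type;
  hom : obj -> obj -> Type;
  idm : forall a, hom a a;
  compm : forall a b c, hom b c -> hom a b -> hom a c;
  compm_idl : forall a b (f : hom a b), compm (idm b) f = f;
  compm_idr : forall a b (f : hom a b), compm f (idm a) = f;
  compmA : forall a b c d (h : hom c d) (g : hom b c) (f : hom a b),
    compm h (compm g f) = compm (compm h g) f
}.

Arguments hom {_} _ _.
Arguments idm {_} _.

Declare Scope cat_scope.
Delimit Scope cat_scope with cat.
Notation "g \o f" := (compm g f) : cat_scope.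
Local Open Scope cat_scope.

Record functor (C D : category) := Functor {
  fobj :> C -> D;
  fmap : forall a b, hom a b -> hom (fobj a) (fobj b);
  fmap_id : forall a, fmap (idm a) = idm (fobj a);
  fmap_comp : forall a b c (g : hom b c) (f : hom a b),
    fmap (g \o f) = fmap g \o fmap f
}.

Definition faithful (C D : category) (F : functor C D) : Prop :=
  forall (a b : C) (f g : hom a b), fmap F f = fmap F g -> f = g.

Definition epi (C : category) (a b : C) (f : hom a b) : Prop :=
  forall (c : C) (g h : hom b c), g \o f = h \o f -> g = h.

Record poclass := PoClass {
  carrier :> Type;
  le : relation carrier;
  le_order : order carrier le
}.

Definition poclass_iso (P Q : poclass) : Prop :=
  exists phi : P -> Q,
    bijective phi /\ forall x y : P, le x y <-> le (phi x) (phi y).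

Lemma sub_order (P : poclass) (S : P -> Prop) :
  order {x : P | S x} (fun x y => le (proj1_sig x) (proj1_sig y)).
Proof.
case: (le_order P) => lexx lett leanti; split.
- by move=> x; apply: lexx.
- by move=> x y z; apply: lett.
- move=> [x Sx] [y Sy] /= lexy leyx.
  by apply: subset_eq_compat; apply: leanti.
Qed.

Definition sub_poclass (P : poclass) (S : P -> Prop) : poclass :=
  PoClass (sub_order S).

Section Quotients.
Variables (C D : category) (F : functor C D).

Definition F_epi (a b : C) (f : hom a b) : Prop := epi (fmap F f).

Record EpiF (A : C) := MkEpiF {
  target : C;
  arrow : hom A target;
  arrow_epi : F_epi arrow
}.

Definition epi_le (A : C) (f g : EpiF A) : Prop :=
  exists h : hom (target f) (target g), arrow g = h \o arrow f.

Definition epi_sim (A : C) (f g : EpiF A) : Prop :=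
  epi_le f g /\ epi_le g f.

Lemma epi_le_refl (A : C) (f : EpiF A) : epi_le f f.
Proof. by exists (idm _); rewrite compm_idl. Qed.

Lemma epi_le_trans (A : C) (g f h : EpiF A) :
  epi_le f g -> epi_le g h -> epi_le f h.
Proof. by move=> [u eg] [v eh]; exists (v \o u); rewrite eh eg compmA. Qed.

(* An F-quotient is an equivalence class of epi_sim, taken literally as a
   subclass of EpiF A; with functional and propositional extensionality,
   Leibniz equality of F-quotients is equality of equivalence classes. *)
Definition Quo_carrier (A : C) : Type :=
  {X : EpiF A -> Prop | exists f, X = epi_sim f}.

Definition quo (A : C) (f : EpiF A) : Quo_carrier A :=
  exist _ (epi_sim f) (ex_intro _ f eq_refl).

Definition quo_le (A : C) (x y : Quo_carrier A) : Prop :=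
  exists f g, x = quo f /\ y = quo g /\ epi_le f g.

Lemma quoP (A : C) (x : Quo_carrier A) : exists f, x = quo f.
Proof.
case: x => X p; case: (p) => f e; exists f.
by apply: subset_eq_compat.
Qed.

Lemma quo_eq (A : C) (f g : EpiF A) : quo f = quo g <-> epi_sim f g.
Proof.
split=> [e|[fg gf]].
  have : epi_sim g g by split; apply: epi_le_refl.
  by rewrite -[epi_sim g g]/(proj1_sig (quo g) g) -e.
have e : epi_sim f = epi_sim g.
  apply: functional_extensionality => h; apply: propositional_extensionality.
  by split=> -[u v]; split; eauto using epi_le_trans.
by apply: subset_eq_compat.
Qed.

Lemma quo_leE (A : C) (f g : EpiF A) : quo_le (quo f) (quo g) <-> epi_le f g.
Proof.
split=> [[f' [g' [/quo_eq[ff' _] [/quo_eq[_ g'g] le']]]]|fg].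
  by eauto using epi_le_trans.
by exists f, g.
Qed.

Lemma quo_order (A : C) : order (Quo_carrier A) (@quo_le A).
Proof.
split.
- by move=> x; have [f ->] := quoP x; apply/quo_leE/epi_le_refl.
- move=> x y z; have [f ->] := quoP x; have [g ->] := quoP y.
  have [h ->] := quoP z => /quo_leE fg /quo_leE gh.
  by apply/quo_leE; apply: epi_le_trans gh.
- move=> x y; have [f ->] := quoP x; have [g ->] := quoP y.
  by move=> /quo_leE fg /quo_leE gf; apply/quo_eq.
Qed.

Definition Quo (A : C) : poclass := PoClass (@quo_order A).

Definition up_quo (A : C) (f : EpiF A) : poclass :=
  sub_poclass (P := Quo A)
    (fun x => exists g : EpiF A, x = quo g /\ epi_le f g).

End Quotients.

Arguments arrow_epi {C D F A} e [c g h] _.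

(* Main.v *)
Require Import Defs.
From Stdlib Require Import IndefiniteDescription.
From Corelib Require Import ssreflect ssrfun.

Set Implicit Arguments.
Unset Strict Implicit.
Unset Printing Implicit Defensive.

Local Open Scope cat_scope.

(** The isomorphism is induced by precomposition with [f], sending an
    F-epimorphism [u] out of [A/f] to [u \o f]. It reaches every class above
    [f], because [h] is an F-epimorphism as soon as [h \o f] is. It reflects
    the preorder, because [F] is faithful and therefore [f], being an
    F-epimorphism, can be cancelled on the right in [C]. *)

(** Choice turns [R] into maps both ways. Since [R] transports the order in both directions,
    antisymmetry forces these maps to be mutually inverse, so no separate proof of functionality or
    injectivity is required of [R]. *)
Lemma poclass_iso_of_correspondence (P Q : poclass) (R : P -> Q -> Prop) :
  (forall x, exists y, R x y) -> (forall y, exists x, R x y) ->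
  (forall x x' y y', R x y -> R x' y' -> le x x' <-> le y y') ->
  poclass_iso P Q.
Proof.
move=> /functional_choice[phi Rphi] /functional_choice[psi Rpsi] Rle.
have [reflP _ antiP] := le_order P; have [reflQ _ antiQ] := le_order Q.
exists phi; split; last by move=> x y; apply: Rle.
exists psi => [x|y].
(* Both [psi (phi x)] and [x] are related to [phi x], so each inequality between them reduces to
   reflexivity at [phi x]. *)
- by apply: antiP; [apply/(Rle _ _ _ (phi x)) | apply/(Rle _ _ (phi x))];
    try apply: reflQ.
- by apply: antiQ; [apply/(Rle (psi y)) | apply/(Rle _ (psi y))];
    try apply: reflP.
Qed.

Lemma epi_comp (C : category) (a b c : C) (g : hom b c) (f : hom a b) :
  epi f -> epi g -> epi (g \o f).
Proof. by move=> ef eg d u v; rewrite !compmA => /ef/eg. Qed.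

Lemma epi_of_comp (C : category) (a b c : C) (g : hom b c) (f : hom a b) :
  epi (g \o f) -> epi g.
Proof. by move=> egf d u v e; apply: egf; rewrite !compmA e. Qed.

Section Precomposition.
Variables (C D : category) (F : functor C D).

Lemma F_epi_comp (a b c : C) (g : hom b c) (f : hom a b) :
  F_epi F f -> F_epi F g -> F_epi F (g \o f).
Proof. by rewrite /F_epi fmap_comp; apply: epi_comp. Qed.

Lemma F_epi_of_comp (a b c : C) (g : hom b c) (f : hom a b) :
  F_epi F (g \o f) -> F_epi F g.
Proof. by rewrite /F_epi fmap_comp; apply: epi_of_comp. Qed.

Lemma faithful_F_epi (a b : C) (f : hom a b) :
  faithful F -> F_epi F f -> epi f.
Proof.
by move=> hF ef c g h e; apply: hF; apply: ef; rewrite -!fmap_comp e.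
Qed.

Variables (A : C) (f : EpiF F A).

Definition precomp (u : EpiF F (target f)) : EpiF F A :=
  MkEpiF (F_epi_comp (@arrow_epi _ _ _ _ f) (@arrow_epi _ _ _ _ u)).

Lemma le_precomp (u : EpiF F (target f)) : epi_le f (precomp u).
Proof. by exists (arrow u). Qed.

Lemma precomp_le (u v : EpiF F (target f)) :
  faithful F -> epi_le (precomp u) (precomp v) <-> epi_le u v.
Proof.
move=> hF; split=> -[h e]; exists h; last by rewrite /= e compmA.
apply: (faithful_F_epi hF (@arrow_epi _ _ _ _ f)).
by rewrite -compmA; apply: e.
Qed.

Lemma le_precompP (g : EpiF F A) :
  epi_le f g -> exists u, epi_sim g (precomp u).
Proof.
case: g => B g eg [/= h e]; subst g.
(* The witness has arrow [h]. After [subst], the two sides differ only in their proofs of [F_epi],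
   so identities give both inequalities. *)
by exists (MkEpiF (F_epi_of_comp eg)); split; exists (idm _);
  rewrite compm_idl.
Qed.

End Precomposition.

Theorem theorem2p8 (C D : category) (F : functor C D) (hF : faithful F)
  (A : C) (f : EpiF F A) :
  poclass_iso (up_quo f) (Quo F (target f)).
Proof.
(* Relating classes through some common representative [u] avoids choosing one; independence of [u]
   is contained in the order condition. *)
pose R (x : up_quo f) (y : Quo F (target f)) :=
  exists u, proj1_sig x = quo (precomp u) /\ y = quo u.
apply: (@poclass_iso_of_correspondence _ _ R).
- move=> x; have [g [xg fg]] := proj2_sig x.
  have [u /quo_eq gu] := le_precompP fg.
  by exists (quo u), u; rewrite xg.
- move=> y; have [u ->] := quoP y.
  have up : exists g, quo (precomp u) = quo g /\ epi_le f g.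
    by exists (precomp u); split; last apply: le_precomp.
  by exists (exist _ (quo (precomp u)) up), u.
- move=> x x' _ _ [u [xu ->]] [v [xv ->]].
  rewrite /= xu xv; split.
  + by move/quo_leE/(precomp_le _ _ hF)/quo_leE.
  + by move/quo_leE/(precomp_le _ _ hF)/quo_leE.
Qed.
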